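(* Let $G$ be a finite abelian group, $\mathbb{F}$ a field, and $K=\mathbb{F}(\omega)$ an extension of $\mathbb{F}$ generated by an element $\omega$ of multiplicative order $\exp(G)$, with $\Gamma$ the automorphism group of the field extension $K$ of $\mathbb{F}$. Let $d$ be a positive integer such that for all $\Gamma$-stable subsets $I$ of $\widehat G$, the monoid $\mathcal{B}(\widehat G)_I$ is contained in the $\mathbb{Z}$-submodule of $\mathcal{F}(\widehat G,\mathbb{Z})$ generated by $\{m\in\mathcal{B}(\widehat G)_I\mid \sum_{\psi\in\widehat G}m(\psi)\le d\}$. Then we have: (i) $\beta_{\mathrm{sep}}(G,\mathcal{F}(G,\mathbb{F}))\le d$. (ii) $\beta_{\mathrm{sep}}^{\mathbb{F}}(G)\le d$.
   Context: $\exp(G)$ is the least common multiple of the orders of the elements of $G$; the existence of $K$ forces that $\mathrm{char}(\mathbb{F})$ does not divide $|G|$. $\widehat G$ is the group of homomorphisms $G\to K^\times$ under pointwise multiplication, and $\Gamma$ acts on $\widehat G$ by $(\gamma\cdot\chi)(g)=\gamma(\chi(g))$. $\mathcal{F}(\widehat G,\mathbb{Z})$ is the abelian group of integer valued functions on $\widehat G$ under pointwise addition. $\mathcal{B}(\widehat G)$ is the monoid of functions $m:\widehat G\to\mathbb{Z}_{\geq 0}$ with $\prod_{\psi\in\widehat G}\psi^{m(\psi)}=1_{\widehat G}$, and for $I\subseteq\widehat G$, $\mathcal{B}(\widehat G)_I:=\{m\in\mathcal{B}(\widehat G)\mid m(\psi)=0\text{ for all }\psi\in\widehat G\setminus I\}$.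 $\mathcal{F}(G,\mathbb{F})$ is the regular representation of $G$ over $\mathbb{F}$: the space of functions $G\to\mathbb{F}$ with $(g\cdot f)(h)=f(g^{-1}h)$. For a finite dimensional representation $V$ of $G$ over $\mathbb{F}$, $\mathbb{F}[V]$ is the coordinate ring (polynomial algebra in the coordinate functions on $V$, with standard grading), with $G$-action $(g\cdot f)(v)=f(g^{-1}v)$, and $\mathbb{F}[V]^G$ is the subalgebra of invariants. $\beta_{\mathrm{sep}}(G,V)$ is the minimal positive integer $d$ such that for any $v,w\in V$ with $G\cdot v\neq G\cdot w$ there exists an $f\in\mathbb{F}[V]^G$ of degree at most $d$ with $f(v)\neq f(w)$. $\beta_{\mathrm{sep}}^{\mathbb{F}}(G)$ is the maximum of $\beta_{\mathrm{sep}}(G,V)$ as $V$ ranges over all finite dimensional representations of $G$ over $\mathbb{F}$. *)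

(* Defs.v *)
From HB Require Import structures.
From Stdlib Require Import ClassicalEpsilon.
From mathcomp Require Import all_boot all_algebra all_fingroup all_solvable.
From mathcomp Require Import all_field mxrepresentation mpoly.

Set Implicit Arguments.
Unset Strict Implicit.
Unset Printing Implicit Defensive.

Import GRing.Theory.
Local Open Scope ring_scope.

(* The group G^ of homomorphisms from G to the units of K. Values are nonzero
   automatically, since chi 1 = 1 and G is a group (lemma dual_neq0). *)
Section Dual.

Variables (G : finGroupType) (K : fieldType).

Definition is_dual (chi : {ffun G -> K}) : bool :=
  (chi 1%g == 1) && [forall x, forall y, chi (x * y)%g == chi x * chi y].

Record dual := Dual { dual_fun :> {ffun G -> K}; _ : is_dual dual_fun }.

HB.instance Definition _ := [isSub for dual_fun].
HB.instance Definition _ := [Choice of dual by <:].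

Lemma is_dualP (chi : {ffun G -> K}) :
  reflect (chi 1%g = 1 /\ {morph chi : x y / (x * y)%g >-> x * y})
          (is_dual chi).
Proof.
apply: (iffP andP) => [[/eqP chi1 /forallP chiM] | [chi1 chiM]].
  by split=> // x y; apply/eqP; have /forallP := chiM x; apply.
by split; [apply/eqP | apply/forallP=> x; apply/forallP=> y; apply/eqP].
Qed.

Lemma dual1 (chi : dual) : chi 1%g = 1.
Proof. by case/is_dualP: (valP chi). Qed.

Lemma dualM (chi : dual) : {morph chi : x y / (x * y)%g >-> x * y}.
Proof. by case/is_dualP: (valP chi). Qed.

Lemma dual_neq0 (chi : dual) x : chi x != 0.
Proof.
apply/eqP=> chix0; have := oner_neq0 K.
by rewrite -(dual1 chi) -(mulgV x) dualM chix0 mul0r eqxx.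
Qed.

Lemma dualX (chi : dual) x n : chi (x ^+ n)%g = chi x ^+ n.
Proof.
by elim: n => [|n IHn]; rewrite ?expg0 ?dual1 // expgS dualM IHn exprS.
Qed.

(* G^ is finite because every value is a root of 'X^#|G| - 1. Equality of K is
   decidable but root finding is not, hence the use of classical choice. *)
Lemma poly_roots_seq (p : {poly K}) :
  p != 0 -> exists rs : seq K, forall x, root p x -> x \in rs.
Proof.
have [n] := ubnP (size p); elim: n p => // n IHn p lt_p_n p_neq0.
have [[a /factor_theorem [q def_p]] | no_root] := classic (exists a, root p a).
  have q_neq0 : q != 0 by apply: contraNneq p_neq0 => q0; rewrite def_p q0 mul0r.
  have lt_q_n : (size q < n)%N.
    by move: lt_p_n; rewrite def_p size_Mmonic ?monicXsubC // size_XsubC addn2.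
  have [rs rsP] := IHn q lt_q_n q_neq0.
  exists (a :: rs) => x; rewrite def_p rootM root_XsubC inE.
  by case/orP=> [/rsP-> | ->]; rewrite ?orbT.
by exists [::] => x px; case: no_root; exists x.
Qed.

Lemma dual_finite : exists s : seq dual, forall chi, chi \in s.
Proof.
have G_gt0 : (0 < #|[set: G]|)%N by apply: cardG_gt0.
have [|rs rsP] := @poly_roots_seq ('X^#|[set: G]| - 1).
  by rewrite -size_poly_eq0 size_XnsubC.
pose dec (f : {ffun G -> seq_sub rs}) : {ffun G -> K} := [ffun x => ssval (f x)].
exists (pmap insub [seq dec f | f : {ffun G -> seq_sub rs}]) => chi.
have chi_rs x : chi x \in rs.
  apply: rsP; rewrite rootE !hornerE -dualX.
  by rewrite expg_cardG ?inE // dual1 subrr.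
rewrite mem_pmap; apply/mapP; exists (val chi); last by rewrite valK.
apply/mapP; exists [ffun x => SeqSub (chi_rs x)]; first by rewrite mem_enum.
by apply/ffunP=> x; rewrite !ffunE.
Qed.

Definition dual_seq : seq dual :=
  proj1_sig (constructive_indefinite_description _ dual_finite).

Fact dual_seqP chi : chi \in dual_seq.
Proof. exact: proj2_sig (constructive_indefinite_description _ dual_finite) chi. Qed.

Fact dual_seq_subK : cancel (fun chi => SeqSub (dual_seqP chi)) (@ssval _ _).
Proof. by []. Qed.

HB.instance Definition _ := Countable.copy dual (can_type dual_seq_subK).
HB.instance Definition _ : isFinite dual := CanIsFinite dual_seq_subK.

Fact dual_mul_subproof (chi psi : dual) : is_dual [ffun x => chi x * psi x].
Proof.
by apply/is_dualP; split=> [|x y]; rewrite !ffunE ?dual1 ?mulr1 // !dualM mulrACA.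
Qed.
Definition dual_mul chi psi := Dual (dual_mul_subproof chi psi).

Fact dual_one_subproof : is_dual [ffun=> 1].
Proof. by apply/is_dualP; split=> [|x y]; rewrite !ffunE ?mulr1. Qed.
Definition dual_one := Dual dual_one_subproof.

Fact dual_inv_subproof (chi : dual) : is_dual [ffun x => (chi x)^-1].
Proof.
by apply/is_dualP; split=> [|x y]; rewrite !ffunE ?dual1 ?invr1 // dualM invfM.
Qed.
Definition dual_inv chi := Dual (dual_inv_subproof chi).

Fact dual_mulA : associative dual_mul.
Proof. by move=> a b c; apply/val_inj/ffunP=> x; rewrite !ffunE mulrA. Qed.
Fact dual_mul1 : left_id dual_one dual_mul.
Proof. by move=> a; apply/val_inj/ffunP=> x; rewrite !ffunE mul1r. Qed.
Fact dual_mulV : left_inverse dual_one dual_inv dual_mul.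
Proof.
by move=> a; apply/val_inj/ffunP=> x; rewrite !ffunE mulVf ?dual_neq0.
Qed.

HB.instance Definition _ :=
  Finite_isGroup.Build dual dual_mulA dual_mul1 dual_mulV.

Fact dual_act_subproof (gamma : {rmorphism K -> K}) (chi : dual) :
  is_dual [ffun x => gamma (chi x)].
Proof.
by apply/is_dualP; split=> [|x y]; rewrite !ffunE ?dual1 ?rmorph1 // dualM rmorphM.
Qed.
Definition dual_act gamma chi := Dual (dual_act_subproof gamma chi).

(* in_B and in_BI are membership in the monoids B(G^) and B(G^)_I. *)
Definition in_B (m : {ffun dual -> nat}) : Prop :=
  (\prod_psi psi ^+ m psi)%g = 1%g :> dual.

Definition in_BI (I : {set dual}) (m : {ffun dual -> nat}) : Prop :=
  in_B m /\ (forall psi, psi \notin I -> m psi = 0%N).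

Definition total_mult (m : {ffun dual -> nat}) : nat := \sum_psi m psi.

Definition to_int (m : {ffun dual -> nat}) : {ffun dual -> int} :=
  [ffun psi => (m psi)%:Z].

End Dual.

Definition Zspan (V : zmodType) (S : V -> Prop) (v : V) : Prop :=
  exists k (s : k.-tuple V), (forall u, u \in s -> S u) /\ inIntSpan s v.

Definition Gamma_stable (G : finGroupType) (F : fieldType) (K : fieldExtType F)
    (I : {set dual G K}) : Prop :=
  forall gamma : 'AEnd(K), kAut 1 {:K} gamma ->
  forall chi, chi \in I -> dual_act gamma chi \in I.

(* A representation of G on V = F^n is an mx_representation rG acting on the
   left on column vectors: g . v = rG g *m v. *)
Section Separation.

Variables (G : finGroupType) (F : fieldType).

Section Representation.

Variables (n : nat) (rG : mx_representation F [set: G] n).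

Definition orb (v : 'cV[F]_n) : seq 'cV[F]_n := codom (fun g => rG g *m v).

(* (g . f)(v) = f(g^-1 . v) on F[V] = F['X_0, ..., 'X_(n-1)]. Since F may be
   finite, this is formal substitution, not equality of polynomial functions. *)
Definition mpoly_act (g : G) (f : {mpoly F[n]}) : {mpoly F[n]} :=
  f \mPo [tuple \sum_j rG g^-1%g i j *: 'X_j | i < n].

Definition invariant (f : {mpoly F[n]}) : Prop := forall g, mpoly_act g f = f.

Definition eval_cV (f : {mpoly F[n]}) (v : 'cV[F]_n) : F := f.@[fun i => v i 0].

Lemma eval_mpoly_act g f v :
  eval_cV (mpoly_act g f) v = eval_cV f (rG g^-1%g *m v).
Proof.
rewrite /eval_cV /mpoly_act comp_mpoly_meval; apply: meval_eq => i.
rewrite tnth_map tnth_ord_tuple raddf_sum mxE; apply: eq_bigr => j _ /=.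
by rewrite mevalZ mevalXU.
Qed.

(* msize is one more than the total degree. *)
Definition separating (d : nat) : Prop :=
  forall v w : 'cV[F]_n, ~ orb v =i orb w ->
  exists f : {mpoly F[n]},
    [/\ invariant f, (msize f <= d.+1)%N & eval_cV f v <> eval_cV f w].

(* b = beta_sep(G, V) *)
Definition is_beta_sep (b : nat) : Prop :=
  [/\ (0 < b)%N, separating b
    & forall b', (0 < b')%N -> separating b' -> (b <= b')%N].

End Representation.

(* b = beta_sep^F(G), the maximum of beta_sep(G, V) over all V *)
Definition is_beta_sep_max (b : nat) : Prop :=
  (forall n (rG : mx_representation F [set: G] n),
     exists2 b', is_beta_sep rG b' & (b' <= b)%N) /\
  (exists n (rG : mx_representation F [set: G] n), is_beta_sep rG b).

(* The regular representation on functions f : G -> F is given by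
   (g . f)(h) = f(g^-1 h); f is represented by the column fun_cV f of its
   values. The library's regular_repr is instead tailored to row vectors. *)
Definition fun_act (g : G) (f : {ffun G -> F}) : {ffun G -> F} :=
  [ffun h => f (g^-1 * h)%g].

Definition fun_cV (f : {ffun G -> F}) : 'cV[F]_#|G| :=
  \col_i f (enum_val i).

Definition fun_mx (g : G) : 'M[F]_#|G| :=
  \matrix_(i, j) (enum_val j == g^-1 * enum_val i :> G)%g%:R.

Lemma fun_mxE g (v : 'cV[F]_#|G|) i :
  (fun_mx g *m v) i 0 = v (enum_rank (g^-1 * enum_val i)%g) 0.
Proof.
rewrite mxE (bigD1 (enum_rank (g^-1 * enum_val i)%g)) //= big1 => [|j neq_j].
  by rewrite mxE enum_rankK eqxx mul1r addr0.
by rewrite mxE (can2_eq enum_valK enum_rankK) (negPf neq_j) mul0r.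
Qed.

Lemma fun_cV_act g f : fun_cV (fun_act g f) = fun_mx g *m fun_cV f.
Proof.
by apply/colP=> i; rewrite fun_mxE !mxE ffunE enum_rankK.
Qed.

Lemma fun_cV_bij : bijective fun_cV.
Proof.
exists (fun v : 'cV_#|G| => [ffun h => v (enum_rank h) 0]) => [f | v].
  by apply/ffunP=> h; rewrite ffunE mxE enum_rankK.
by apply/colP=> i; rewrite mxE ffunE enum_valK.
Qed.

Fact fun_mx_repr : mx_repr [set: G] fun_mx.
Proof.
split=> [|x y _ _]; apply/matrixP=> i j.
  by rewrite !mxE invg1 mul1g (inj_eq enum_val_inj) eq_sym.
rewrite [RHS]mxE (bigD1 (enum_rank (x^-1 * enum_val i)%g)) //= big1 => [|k neq_k].
  by rewrite !mxE !enum_rankK eqxx mul1r addr0 invMg mulgA.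
by rewrite !mxE (can2_eq enum_valK enum_rankK) (negPf neq_k) mul0r.
Qed.

Definition fun_repr := MxRepresentation fun_mx_repr.

End Separation.

(* Main.v *)
Require Import Defs.
From Stdlib Require Import Classical_Prop.
From mathcomp Require Import all_boot all_algebra all_fingroup all_solvable.
From mathcomp Require Import all_field mxrepresentation mpoly.

(* Let v, w in F^n have equal F-invariants of degree at most d. After extending
   scalars to K the group acts diagonally, and averaging monomials over G shows
   that every product of at most d weight coordinates whose weights multiply to 1
   takes the same value at v and w. The set I of weights on which v has a nonzero
   component is Gamma-stable, because v has entries in F. The multiple #|G| * chi
   of chi in I is a relation, so some generating relation of degree at most d
   involves chi; varying one of its factors shows that the chi-components satisfy
   w_chi = t_chi v_chi with t_chi nonzero, and t satisfies every relation in B_I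
   since it satisfies the generating ones. Such a t is evaluation at some h in G,
   whence w = h v. *)

Import GRing.Theory.
Local Open Scope ring_scope.

Set Implicit Arguments.
Unset Strict Implicit.
Unset Printing Implicit Defensive.

(** * Orbit sums of monomials as invariants of bounded degree *)

Section OrbitSums.

Variables (G : finGroupType) (F : fieldType) (n : nat).
Variable rG : mx_representation F [set: G] n.

(** This is [mpoly_act rG g 'X_i], the translate of a coordinate function. *)
Definition row_form (g : G) (i : 'I_n) : {mpoly F[n]} :=
  \sum_j rG g^-1%g i j *: 'X_j.

Lemma mpoly_act_row_form g h i :
  mpoly_act rG g (row_form h i) = row_form (g * h)%g i.
Proof.
rewrite /mpoly_act raddf_sum /=.
under eq_bigr => j _ do
  rewrite linearZ /= comp_mpolyXU -tnth_nth tnth_map tnth_ord_tuple scaler_sumr.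
rewrite exchange_big; apply: eq_bigr => j _ /=.
under eq_bigr => k _ do rewrite scalerA.
by rewrite -scaler_suml invMg repr_mxM ?inE // mxE.
Qed.

Lemma msize_row_form g i : (msize (row_form g i) <= 2)%N.
Proof.
apply: leq_trans (msize_sum _ _ _) _; apply/bigmax_leqP => j _.
by apply: leq_trans (msizeZ_le _ _) _; rewrite msizeX mdeg1.
Qed.

Lemma msize_prod_row_form g k (s : 'I_k -> 'I_n) :
  (msize (\prod_(j < k) row_form g (s j)) <= k.+1)%N.
Proof.
elim: k s => [|k IHk] s; first by rewrite big_ord0 msize1.
rewrite big_ord_recl.
set p := row_form _ _; set q := \prod_(i < k) _.
have [->|p0] := eqVneq p 0; first by rewrite mul0r msize0.
have [->|q0] := eqVneq q 0; first by rewrite mulr0 msize0.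
rewrite msizeM //.
have hp : (msize p <= 2)%N by apply: msize_row_form.
have hq : (msize q <= k.+1)%N by apply: IHk.
by have := leq_add hp hq; case: (msize p + msize q)%N.
Qed.

Definition orbit_sum k (s : 'I_k -> 'I_n) : {mpoly F[n]} :=
  \sum_g \prod_(j < k) row_form g (s j).

Lemma orbit_sum_invariant k (s : 'I_k -> 'I_n) : Defs.invariant rG (orbit_sum s).
Proof.
move=> h; rewrite /orbit_sum /mpoly_act raddf_sum.
rewrite [RHS](reindex_inj (mulgI h)); apply: eq_bigr => g _ /=.
by rewrite rmorph_prod; apply: eq_bigr => j _; apply: mpoly_act_row_form.
Qed.

Lemma msize_orbit_sum k (s : 'I_k -> 'I_n) : (msize (orbit_sum s) <= k.+1)%N.
Proof.
apply: leq_trans (msize_sum _ _ _) _; apply/bigmax_leqP => g _.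
exact: msize_prod_row_form.
Qed.

Lemma eval_orbit_sum k (s : 'I_k -> 'I_n) (v : 'cV[F]_n) :
  eval_cV (orbit_sum s) v = \sum_g \prod_(j < k) (rG g *m v) (s j) 0.
Proof.
rewrite /eval_cV /orbit_sum raddf_sum [RHS](reindex_inj invg_inj).
apply: eq_bigr => g _; rewrite /= rmorph_prod; apply: eq_bigr => j _.
rewrite raddf_sum mxE; apply: eq_bigr => i _ /=.
by rewrite mevalZ mevalXU.
Qed.

End OrbitSums.

(** * Weight coordinates over [K] and their products *)

Section Weights.

Variables (G : finGroupType) (F : fieldType) (K : fieldExtType F) (n : nat).
Variable rG : mx_representation F [set: G] n.

Local Notation rK := (map_repr (in_alg K) rG).
Local Notation "v ^K" := (map_mx (in_alg K) v) (at level 2, format "v ^K").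

(** A row is a linear form on column vectors, so [pairing r] is a coordinate of weight [chi]; the
    zero row is allowed. *)
Definition weight_row (chi : dual G K) (r : 'rV[K]_n) : Prop :=
  forall g, r *m rK g = chi g *: r.

Definition pairing (r : 'rV[K]_n) (x : 'cV[K]_n) : K := (r *m x) 0 0.

Lemma pairing_rG chi r g (v : 'cV[F]_n) : weight_row chi r ->
  pairing r (rG g *m v)^K = chi g * pairing r v^K.
Proof. by move=> wr; rewrite /pairing map_mxM mulmxA wr -scalemxAl mxE. Qed.

(** Replacing [v] by its translate under [g] multiplies the product of pairings by the product of
    the weights at [g], which is 1, so the product can be summed over [G]. Expanding each row in its
    entries then leaves orbit sums, with coefficients independent of [v]. *)
Lemma prod_pairing_orbit_sum (s : seq (dual G K * 'rV[K]_n)) (v : 'cV[F]_n) :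
  (forall p, p \in s -> weight_row p.1 p.2) ->
  (forall g, \prod_(p <- s) p.1 g = 1) ->
  #|G|%:R * \prod_(p <- s) pairing p.2 v^K =
  \sum_(f : {ffun 'I_(size s) -> 'I_n})
     (\prod_j (tnth (in_tuple s) j).2 0 (f j)) *
     in_alg K (eval_cV (orbit_sum rG f) v).
Proof.
move=> ws prod1; pose t := tnth (in_tuple s).
have orbE f : in_alg K (eval_cV (orbit_sum rG f) v) =
    \sum_g \prod_(j < size s) (rG g *m v)^K (f j) 0.
  rewrite eval_orbit_sum rmorph_sum; apply: eq_bigr => g _.
  by rewrite rmorph_prod; apply: eq_bigr => j _; rewrite [RHS]mxE.
under [RHS]eq_bigr => f _ do rewrite orbE mulr_sumr.
rewrite exchange_big /=.
transitivity (\sum_(g : G) \prod_(p <- s) pairing p.2 v^K).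
  by rewrite sumr_const mulr_natl.
apply: eq_bigr => g _.
under [RHS]eq_bigr => f _ do rewrite -big_split.
rewrite -(bigA_distr_bigA (fun j i => (t j).2 0 i * (rG g *m v)^K i 0)).
rewrite -[LHS]mul1r -[X in X * _](prod1 g) -big_split big_tnth; apply: eq_bigr => j _ /=.
by rewrite -pairing_rG; [rewrite /pairing mxE | apply/ws/mem_tnth].
Qed.

Variables (d : nat) (v w : 'cV[F]_n).
Hypothesis G_neq0 : #|G|%:R != 0 :> K.
Hypothesis eq_inv : forall f, Defs.invariant rG f -> (msize f <= d.+1)%N ->
  eval_cV f v = eval_cV f w.

Lemma eq_prod_pairing (s : seq (dual G K * 'rV[K]_n)) :
  (size s <= d)%N -> (forall p, p \in s -> weight_row p.1 p.2) ->
  (forall g, \prod_(p <- s) p.1 g = 1) ->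
  \prod_(p <- s) pairing p.2 v^K = \prod_(p <- s) pairing p.2 w^K.
Proof.
move=> s_d ws prod1; apply: (mulfI G_neq0).
rewrite !prod_pairing_orbit_sum //; apply: eq_bigr => f _.
congr (_ * in_alg K _); apply: eq_inv; first exact: orbit_sum_invariant.
by apply: leq_trans (msize_orbit_sum _ _) _; rewrite ltnS.
Qed.

End Weights.

(** * Simultaneous diagonalisation over [K] *)

Section Diagonalization.

Variables (G : finGroupType) (K : fieldType) (omega : K).
Hypothesis abelG : abelian [set: G].
Hypothesis prim_omega : (exponent [set: G]).-primitive_root omega.

(** A primitive root of unity of order e forces the characteristic not to divide e, and the exponent
    of [G] has the same prime divisors as its order. *)
Lemma primitive_exponent_card_neq0 : #|G|%:R != 0 :> K.
Proof.
apply: (prim_root_pi_eq0 prim_omega); rewrite pi_of_exponent.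
by rewrite -cardsT pnat_pi ?cardG_gt0.
Qed.

(** With e the exponent of [G], the matrix is a zero of X^e - 1, which splits into distinct linear
    factors whose roots are the powers of [omega]. *)
Lemma repr_mx_diagonalizable n (rho : mx_representation K [set: G] n.+1) g :
  exists2 P : 'M[K]_n.+1, P \in unitmx & similar_diag P (rho g).
Proof.
apply/diagonalizableP; exists [seq omega ^+ i | i <- index_iota 0 (exponent [set: G])].
  rewrite map_inj_in_uniq ?iota_uniq // => i j.
  rewrite !mem_index_iota => /andP[_ lti] /andP[_ ltj] /eqP.
  by rewrite (eq_prim_root_expr prim_omega) !modn_small // => /eqP.
rewrite big_map factor_Xn_sub_1 //; apply: mxminpoly_min.
rewrite rmorphB rmorphXn rmorph1 /= horner_mx_X.
suff -> : rho g ^+ exponent [set: G] = rho (g ^+ exponent [set: G])%g.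
  by rewrite expg_exponent ?inE // repr_mx1 subrr.
elim: (exponent _) => [|k IHk]; first by rewrite repr_mx1.
by rewrite exprS IHk expgS repr_mxM ?inE.
Qed.

(* Simultaneous diagonalisation of the commuting matrices rho g gives a basis of
   rows r as in the hypothesis. *)
Lemma eq_weight_rows n (rho : mx_representation K [set: G] n) (x y : 'cV[K]_n) :
  (forall (chi : dual G K) (r : 'rV[K]_n),
     (forall g, r *m rho g = chi g *: r) -> r *m x = r *m y) ->
  x = y.
Proof.
case: n rho x y => [|n] rho x y xy; first by apply/colP; case.
have [P Punit /allP Pdiag] : exists2 P : 'M[K]_n.+1, P \in unitmx &
    all [pred A | similar_diag P A] [seq rho g | g <- enum G].
  apply/codiagonalizableP; split=> [_ _ /mapP[g _ ->] /mapP[h _ ->]|_ /mapP[g _ ->]].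
    rewrite /comm_mx -!repr_mxM ?inE //.
    by rewrite (centsP abelG) ?inE.
  exact: repr_mx_diagonalizable.
pose D g i := (P *m rho g *m invmx P) i i.
have PrhoE g i : row i P *m rho g = D g i *: row i P.
  have /Pdiag : rho g \in [seq rho g | g <- enum G] by rewrite map_f ?mem_enum.
  move/(similar_diagP _ Punit) => offdiag.
  have -> : row i P *m rho g = row i (P *m rho g *m invmx P) *m P.
    by rewrite -!row_mul mulmxKV.
  apply/rowP => j; rewrite mxE (bigD1 i) //= big1 ?addr0.
    by rewrite [row i _ _ _]mxE [RHS]mxE [row i P _ _]mxE.
  by move=> k nki; rewrite [row _ _ _ _]mxE offdiag ?mul0r // eq_sym.
have rowP_neq0 i : row i P != 0.
  apply/eqP=> Pi0; have := congr1 (mulmx^~ (invmx P)) Pi0.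
  rewrite -row_mul mulmxV // mul0mx => /rowP/(_ i); rewrite !mxE eqxx.
  by apply/eqP/oner_neq0.
have scaleI i : injective (fun a : K => a *: row i P).
  move=> a b /eqP; rewrite -subr_eq0 -scalerBl scaler_eq0 (negPf (rowP_neq0 i)) orbF.
  by rewrite subr_eq0 => /eqP.
(* Row [i] of [P] is nonzero, so its eigenvalue is determined by [g] and is therefore multiplicative
   in [g]. *)
have dualD i : is_dual [ffun g => D g i].
  apply/is_dualP; split=> [|g h]; rewrite !ffunE; apply: (scaleI i) => /=.
    by rewrite -PrhoE repr_mx1 mulmx1 scale1r.
  by rewrite -PrhoE repr_mxM ?inE // mulmxA PrhoE -scalemxAl PrhoE scalerA.
rewrite -[x](mulKmx Punit) -[y](mulKmx Punit); congr (_ *m _).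
apply/row_matrixP => i; rewrite !row_mul; apply: (xy (Dual (dualD i))) => g.
by rewrite ffunE PrhoE.
Qed.

End Diagonalization.

(** * Characters and evaluation at points of [G] *)

Section Duality.

Variables (G : finGroupType) (K : fieldType).
Implicit Types (chi psi : dual G K) (m : {ffun dual G K -> nat}).

Lemma dual_mulE chi psi g : (chi * psi)%g g = chi g * psi g.
Proof. by rewrite ffunE. Qed.

Lemma dual_oneE g : (1%g : dual G K) g = 1.
Proof. by rewrite ffunE. Qed.

Lemma dual_prodE m g :
  (\prod_psi psi ^+ m psi)%g g = \prod_(psi : dual G K) psi g ^+ m psi.
Proof.
rewrite (big_morph (fun chi : dual G K => chi g)
  (fun chi psi => dual_mulE chi psi g) (dual_oneE g)).
apply: eq_bigr => psi _.
by elim: (m psi) => [|k IHk]; rewrite ?expg0 ?dual_oneE // expgS dual_mulE IHk exprS.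
Qed.

Lemma dual_eqP chi psi : (forall g, chi g = psi g) -> chi = psi.
Proof. by move=> eq_cp; apply/val_inj/ffunP. Qed.

Lemma in_BP m : in_B m <-> forall g, \prod_(psi : dual G K) psi g ^+ m psi = 1.
Proof.
split=> [Bm g|Bm]; first by rewrite -dual_prodE Bm dual_oneE.
by apply: dual_eqP => g; rewrite dual_prodE Bm dual_oneE.
Qed.

Lemma dual_expr_card chi g : chi g ^+ #|G| = 1.
Proof. by rewrite -dualX -cardsT expg_cardG ?inE // dual1. Qed.

(** Reindexing by [h] shows that multiplication by [chi h] fixes the sum, and a nontrivial [chi] has
    some [chi h] different from 1. *)
Lemma sum_dual chi : \sum_g chi g = if chi == 1%g then #|G|%:R else 0.
Proof.
case: eqVneq => [->|chi1].
  by under eq_bigr do rewrite dual_oneE; rewrite sumr_const.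
have [h chi_h] : exists h, chi h != 1.
  apply/existsP; apply: contraR chi1 => /existsPn chi1; apply/eqP/dual_eqP => g.
  by rewrite dual_oneE; apply/eqP; rewrite -[_ == _]negbK.
have chi_hS : chi h * \sum_g chi g = \sum_g chi g.
  rewrite mulr_sumr [RHS](reindex_inj (mulgI h)).
  by apply: eq_bigr => g _; rewrite dualM.
have /eqP : (chi h - 1) * \sum_g chi g = 0 by rewrite mulrBl mul1r chi_hS subrr.
by rewrite mulf_eq0 subr_eq0 (negPf chi_h) => /eqP.
Qed.


Hypothesis G_neq0 : #|G|%:R != 0 :> K.

Variables (I : {set dual G K}) (t : dual G K -> K).
Hypothesis t_rel : forall m, in_BI I m -> \prod_psi t psi ^+ m psi = 1.

(** Every character value has N-th power 1 for N = [#|G|], so m1 + (N - 1) m2 and N m2 are both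
    relations. Comparing their [t]-products and cancelling the common power gives the equality. *)
Lemma eq_prod_of_relations m1 m2 :
  (forall psi, psi \notin I -> m1 psi = 0%N) ->
  (forall psi, psi \notin I -> m2 psi = 0%N) ->
  (forall g, \prod_(psi : dual G K) psi g ^+ m1 psi
             = \prod_(psi : dual G K) psi g ^+ m2 psi) ->
  \prod_psi t psi ^+ m1 psi = \prod_psi t psi ^+ m2 psi.
Proof.
move=> m1I m2I eq12; set N := #|G|.
have N_gt0 : (0 < N)%N by apply/card_gt0P; exists 1%g.
pose s a b : {ffun dual G K -> nat} := [ffun psi => a * m1 psi + b * m2 psi]%N.
have prod_s (f : dual G K -> K) a b : \prod_psi f psi ^+ s a b psi =
    (\prod_psi f psi ^+ m1 psi) ^+ a * (\prod_psi f psi ^+ m2 psi) ^+ b.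
  rewrite -!prodrXl -big_split; apply: eq_bigr => psi _ /=.
  by rewrite ffunE exprD mulnC [(b * _)%N]mulnC !exprM.
have t_s a b : (a + b = N)%N ->
    (\prod_psi t psi ^+ m1 psi) ^+ a * (\prod_psi t psi ^+ m2 psi) ^+ b = 1.
  move=> abN; rewrite -prod_s; apply: t_rel; split=> [|psi psiI].
    apply/in_BP => g; rewrite prod_s eq12 -exprD abN -prodrXl big1 // => psi _.
    by rewrite exprAC dual_expr_card expr1n.
  by rewrite ffunE m1I // m2I // !muln0.
have := t_s 1%N N.-1; rewrite add1n prednK // expr1 => /(_ erefl) t1.
have := t_s 0%N N erefl; rewrite expr0 mul1r -[in X in X -> _](prednK N_gt0) exprS.
move=> t2; have t2_neq0 : (\prod_psi t psi ^+ m2 psi) ^+ N.-1 != 0.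
  by apply/eqP=> t20; have := oner_neq0 K; rewrite -t1 t20 mulr0 eqxx.
by apply: (mulIf t2_neq0); rewrite t1 t2.
Qed.

(* If no point h works, choose for each g a chi_g in I with t chi_g != chi_g(g).
   The product over g of (chi_g - chi_g(g)) vanishes as a function on G, so by
   linear independence of characters its expansion cancels character by
   character, and then also after substituting t chi_g for chi_g. *)
Lemma exists_evaluation_point : exists h, forall chi, chi \in I -> t chi = chi h.
Proof.
have [/existsP[h /forall_inP th]|] :=
    boolP [exists h, [forall chi in I, t chi == chi h]].
  by exists h => chi chiI; apply/eqP/th.
rewrite negb_exists => /forallP noh; exfalso.
have /fin_all_exists2[x xI t_neq] g : exists2 chi, chi \in I & t chi != chi g.
  by have /forall_inPn[chi chiI neq] := noh g; exists chi.
pose m (J : {set G}) : {ffun dual G K -> nat} :=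
  [ffun psi => #|[pred g in J | x g == psi]|].
(* Expanding the product over [g], the set [J] records the factors from which [x g] is chosen; [c J]
   collects the constants chosen from the others. *)
pose c (J : {set G}) := \prod_g (if g \in J then 1 else - x g g).
have prod_m (f : dual G K -> K) J :
    \prod_psi f psi ^+ m J psi = \prod_(g in J) f (x g).
  rewrite [RHS](partition_big x predT) //=; apply: eq_bigr => psi _.
  rewrite ffunE -prodr_const; apply: eq_big => [g|g /andP[_ /eqP <-]] //.
have expand (f : dual G K -> K) :
    \prod_g (f (x g) - x g g) = \sum_J c J * \prod_psi f psi ^+ m J psi.
  rewrite bigA_distr; apply: eq_bigr => J _.
  rewrite prod_m (big_mkcond (mem J)) -big_split; apply: eq_bigr => g _ /=.
  by case: ifP; rewrite ?mul1r ?mulr1.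
have mI J psi : psi \notin I -> m J psi = 0%N.
  move=> psiI; rewrite ffunE eq_card0 // => g; rewrite !inE.
  by apply: contraNF psiI => /andP[_ /eqP <-].
pose X J := (\prod_psi psi ^+ m J psi)%g.
have : \prod_g (t (x g) - x g g) != 0.
  by apply/prodf_neq0 => g _; rewrite subr_eq0.
rewrite expand (partition_big X predT) //= big1 ?eqxx // => phi _.
(* Orthogonality isolates the coefficient of [phi]: multiplying the expansion by the inverse of
   [phi] and summing over [g] gives [#|G|] times it, while each summand contains the zero factor at
   [h] equal to [g]. *)
have sum_c : \sum_(J | X J == phi) c J = 0.
  apply: (mulfI G_neq0); rewrite mulr0.
  transitivity (\sum_J c J * \sum_g (X J * phi^-1)%g g).
    rewrite mulr_sumr big_mkcond; apply: eq_bigr => J _.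
    by rewrite sum_dual -eq_mulgV1; case: ifP; rewrite ?mulr0 // mulrC.
  under eq_bigr do rewrite mulr_sumr.
  rewrite exchange_big big1 //= => g _.
  transitivity ((phi^-1)%g g * \prod_h (x h g - x h h)).
    rewrite (expand (fun chi => chi g)) mulr_sumr; apply: eq_bigr => J _.
    by rewrite !ffunE /= dual_prodE [LHS]mulrA [LHS]mulrC.
  by rewrite (bigD1 g) //= subrr mul0r mulr0.
have [J0 /eqP XJ0|noJ] := pickP (fun J => X J == phi); last first.
  by rewrite big_pred0.
(* Monomials with the same character [phi] have the same [t]-value, which then factors out. *)
rewrite (eq_bigr (fun J => c J * \prod_psi t psi ^+ m J0 psi)); last first.
  move=> J /eqP XJ; congr (_ * _).
  apply: (eq_prod_of_relations (mI J) (mI J0)) => g; rewrite -!dual_prodE -/(X J) -/(X J0).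
  by rewrite XJ XJ0.
by rewrite -mulr_suml sum_c mul0r.
Qed.

End Duality.

(** * Integer spans and multiplicative relations *)

Lemma Zspan_ind (V : zmodType) (S P : V -> Prop) :
  P 0 -> (forall x y, P x -> P y -> P (x - y)) -> (forall x, S x -> P x) ->
  forall x, Zspan S x -> P x.
Proof.
move=> P0 PB PS x [k [s [sS [a ->]]]].
have PN y : P y -> P (- y) by move=> Py; rewrite -sub0r; apply: PB.
have PD y z : P y -> P z -> P (y + z).
  by move=> Py Pz; rewrite -[z]opprK; apply: PB => //; apply: PN.
have PM y i : P y -> P (y *+ i).
  by move=> Py; elim: i => [|i IHi]; rewrite ?mulr0n // mulrS; apply: PD.
elim/big_ind: _ => // i _; have Psi : P s`_i.
  by apply/PS/sS/mem_nth; rewrite size_tuple.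
by case: (a i) => j; [rewrite -pmulrn | rewrite NegzE -nmulrn; apply: PN]; apply: PM.
Qed.

(** As the [t psi] are nonzero, integer exponents make sense and the product is a homomorphism from
    integer valued functions to the units of [K]; its kernel contains the span of [S]. *)
Lemma prod_expr_Zspan (G : finGroupType) (K : fieldType) (t : dual G K -> K)
  (S : {ffun dual G K -> int} -> Prop) (m : {ffun dual G K -> nat}) :
  (forall psi, t psi != 0) ->
  (forall u, S u -> exists2 m', u = to_int m' & \prod_psi t psi ^+ m' psi = 1) ->
  Zspan S (to_int m) -> \prod_psi t psi ^+ m psi = 1.
Proof.
move=> t_neq0 S1 Sm; pose f (u : {ffun dual G K -> int}) := \prod_psi t psi ^ u psi.
have fE m' : f (to_int m') = \prod_psi t psi ^+ m' psi.
  by apply: eq_bigr => psi _; rewrite ffunE.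
rewrite -fE; apply: (Zspan_ind (P := fun u => f u = 1)) Sm.
- by apply: big1 => psi _; rewrite ffunE.
- move=> x y x1 y1; rewrite -[RHS](divr1 1) -{1}x1 -y1 /f -prodf_div.
  by apply: eq_bigr => psi _; rewrite !ffunE expfzDr // -invr_expz.
by move=> _ /S1[m' -> t1]; rewrite fE.
Qed.

(** * Exponent functions as lists with repetition *)

Section Multisets.

Variable (T : finType).
Implicit Type m : {ffun T -> nat}.

(** In list form, a single occurrence of a factor can be split off from a relation. *)
Definition mult_seq m : seq T := flatten [seq nseq (m x) x | x <- enum T].

Lemma mem_mult_seq m x : (x \in mult_seq m) = (0 < m x)%N.
Proof.
apply/flattenP/idP => [[_ /mapP[y _ ->]]|mx].
  by rewrite mem_nseq => /andP[my /eqP ->].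
exists (nseq (m x) x); last by rewrite mem_nseq mx eqxx.
by apply/mapP; exists x; rewrite ?mem_enum.
Qed.

Lemma prod_mult_seq (K : comNzRingType) (f : T -> K) m :
  \prod_(x <- mult_seq m) f x = \prod_x f x ^+ m x.
Proof.
rewrite big_flatten big_map big_enum; apply: eq_bigr => x _.
by rewrite big_nseq; elim: (m x) => //= i ->; rewrite exprS.
Qed.

Lemma size_mult_seq m : size (mult_seq m) = (\sum_x m x)%N.
Proof.
rewrite size_flatten /shape -map_comp sumnE big_map big_enum.
by apply: eq_bigr => x _; rewrite /= size_nseq.
Qed.

End Multisets.

(** * Supports, weight ratios and separation of orbits *)

Section Separation.

Variables (G : finGroupType) (F : fieldType) (K : fieldExtType F) (omega : K).
Hypothesis abelG : abelian [set: G].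
Hypothesis prim_omega : (exponent [set: G]).-primitive_root omega.
Variable d : nat.
Hypothesis hd : forall I : {set dual G K}, Gamma_stable I ->
  forall m, in_BI I m ->
    Zspan (fun u => exists m',
             [/\ in_BI I m', (total_mult m' <= d)%N & u = to_int m'])
          (to_int m).
Variables (n : nat) (rG : mx_representation F [set: G] n).

Local Notation "v ^K" := (map_mx (in_alg K) v) (at level 2, format "v ^K").

Lemma map_mx_in_alg p q (gamma : 'AEnd(K)) (A : 'M[F]_(p, q)) :
  map_mx gamma A^K = A^K.
Proof. by apply/matrixP=> i j; rewrite !mxE linearZ /= rmorph1. Qed.

(** The matrices [rG g] have entries in [F], which [gamma] fixes. *)
Lemma weight_row_dual_act (gamma : 'AEnd(K)) chi r :
  weight_row rG chi r -> weight_row rG (dual_act gamma chi) (map_mx gamma r).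
Proof.
move=> wr g; rewrite -[X in _ *m X](map_mx_in_alg gamma) -map_mxM wr.
by rewrite map_mxZ ffunE.
Qed.

Lemma pairing_dual_act (gamma : 'AEnd(K)) r (v : 'cV[F]_n) :
  pairing (map_mx gamma r) v^K = gamma (pairing r v^K).
Proof. by rewrite /pairing -[v^K](map_mx_in_alg gamma) -map_mxM mxE map_mx_in_alg. Qed.

Definition is_support (v : 'cV[F]_n) (I : {set dual G K}) : Prop :=
  forall chi, chi \in I <->
    exists r, weight_row rG chi r /\ pairing r v^K != 0.

Lemma exists_support v : exists I, is_support v I.
Proof.
have /fin_all_exists[b bP] (chi : dual G K) : exists b : bool,
    b <-> exists r, weight_row rG chi r /\ pairing r v^K != 0.
  case: (classic (exists r, weight_row rG chi r /\ pairing r v^K != 0)) => H.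
    by exists true.
  by exists false.
by exists [set chi | b chi] => chi; rewrite inE.
Qed.

Lemma support_Gamma_stable v I : is_support v I -> Gamma_stable I.
Proof.
move=> suppI gamma _ chi /suppI[r [wr rv]]; apply/suppI.
exists (map_mx gamma r); split; first exact: weight_row_dual_act.
by rewrite pairing_dual_act fmorph_eq0.
Qed.

Lemma support_rows v I : is_support v I ->
  exists R : dual G K -> 'rV[K]_n, forall chi, chi \in I ->
    weight_row rG chi (R chi) /\ pairing (R chi) v^K != 0.
Proof.
move=> suppI.
suff /fin_all_exists[R RP] (chi : dual G K) : exists r : 'rV[K]_n, chi \in I ->
    weight_row rG chi r /\ pairing r v^K != 0 by exists R.
case: (boolP (chi \in I)) => [/suppI[r ?]|_]; first by exists r.
by exists 0.
Qed.

Section EqualInvariants.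

Variables v w : 'cV[F]_n.
Hypothesis eq_inv : forall f, Defs.invariant rG f -> (msize f <= d.+1)%N ->
  eval_cV f v = eval_cV f w.

Let G_neq0 : #|G|%:R != 0 :> K := primitive_exponent_card_neq0 prim_omega.

(* The multiset #|G| * chi lies in B_I, so some generator of degree at most d
   involves chi. *)
Lemma exists_small_relation (I : {set dual G K}) chi :
  Gamma_stable I -> chi \in I ->
  exists m, [/\ in_BI I m, (total_mult m <= d)%N & (0 < m chi)%N].
Proof.
move=> stabI chiI.
pose m0 : {ffun dual G K -> nat} := [ffun psi => if psi == chi then #|G| else 0%N].
have Bm0 : in_BI I m0.
  split=> [|psi]; last by rewrite ffunE; case: eqP => // ->; rewrite chiI.
  apply/in_BP => g; apply: big1 => psi _; rewrite ffunE.
  by case: ifP; rewrite ?expr0 ?dual_expr_card.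
case: (classic
  (exists m, [/\ in_BI I m, (total_mult m <= d)%N & (0 < m chi)%N])) => // nom.
(* If no small relation involved [chi], all generators, and hence [m0], would vanish there, whereas
   [m0 chi] is [#|G|]. *)
suff : (to_int m0) chi = 0.
  by rewrite !ffunE eqxx => -[/card0_eq/(_ 1%g)].
apply: (Zspan_ind (P := fun u : {ffun dual G K -> int} => u chi = 0)) (hd stabI Bm0).
- by rewrite ffunE.
- by move=> x y x0 y0; rewrite !ffunE x0 y0 subrr.
move=> _ [m [Bm md ->]]; rewrite ffunE; case: (posnP (m chi)) => [-> //|m_gt0].
by case: nom; exists m.
Qed.

(** In a small relation involving [chi], one occurrence of [chi] carries an arbitrary row [r] and
    all other factors keep fixed rows. The ratio of the fixed parts at [v] and [w] does not depend
    on [r]. *)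
Lemma weight_proportional I : is_support v I -> forall chi, chi \in I ->
  exists2 t, t != 0 & forall r, weight_row rG chi r ->
    pairing r w^K = t * pairing r v^K.
Proof.
move=> suppI chi chiI.
have [m [[Bm mI] md m_gt0]] :=
  exists_small_relation (support_Gamma_stable suppI) chiI.
have [R RP] := support_rows suppI.
have /perm_to_rem perm_m : chi \in mult_seq m by rewrite mem_mult_seq.
set L := rem chi _ in perm_m.
have LI psi : psi \in L -> psi \in I.
  move=> psiL; apply: contraLR (m_gt0) => /mI psi0.
  have : psi \in mult_seq m by rewrite (perm_mem perm_m) inE psiL orbT.
  by rewrite mem_mult_seq psi0.
(* The fixed part; [L] may still contain further copies of [chi]. *)
pose c x := \prod_(psi <- L) pairing (R psi) x^K.
have cE r : weight_row rG chi r ->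
    pairing r v^K * c v = pairing r w^K * c w.
  move=> wr; have := eq_prod_pairing G_neq0 eq_inv
    (s := (chi, r) :: [seq (psi, R psi) | psi <- L]).
  rewrite !big_cons !big_map /=; apply.
  - rewrite size_map; have := perm_size perm_m.
    by rewrite size_mult_seq /= => <-.
  - move=> p; rewrite inE => /orP[/eqP -> //|/mapP[psi /LI psiI ->]].
    by have [] := RP psi psiI.
  - move=> g; rewrite big_cons big_map /=.
    transitivity (\prod_(psi <- mult_seq m) psi g).
      by rewrite (perm_big _ perm_m) big_cons.
    by rewrite prod_mult_seq; move/in_BP: Bm.
have cv_neq0 : c v != 0.
  rewrite /c prodf_seq_neq0; apply/allP => psi /LI psiI /=.
  by have [] := RP psi psiI.
have [r0 [wr0 r0v]] : exists r, weight_row rG chi r /\ pairing r v^K != 0.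
  exact/suppI.
(* For [r0] the whole product is nonzero at [v], hence also at [w]. *)
have cw_neq0 : c w != 0.
  apply: contraNneq (mulf_neq0 r0v cv_neq0) => cw0.
  by rewrite cE // cw0 mulr0.
exists (c v / c w); first by rewrite mulf_neq0 ?invr_eq0.
move=> r /cE rE; apply: (mulIf cw_neq0).
by rewrite -rE mulrAC divfK // mulrC.
Qed.

(** For a generator of degree at most [d], equality of the products at [v] and [w] says that the
    nonzero product at [v] is unchanged by the factor in [t]. The general case follows by passing to
    the span. *)
Lemma weight_ratio_relation I (t : dual G K -> K) : is_support v I ->
  (forall chi, t chi != 0) ->
  (forall chi r, chi \in I -> weight_row rG chi r ->
     pairing r w^K = t chi * pairing r v^K) ->
  forall m, in_BI I m -> \prod_psi t psi ^+ m psi = 1.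
Proof.
move=> suppI t_neq0 tE m Bm; have [R RP] := support_rows suppI.
apply: prod_expr_Zspan t_neq0 _ (hd (support_Gamma_stable suppI) Bm).
move=> _ {m Bm}[m [[Bm mI] md ->]]; exists m => //.
have m_I psi : psi \in mult_seq m -> psi \in I.
  by rewrite mem_mult_seq; apply: contraLR => /mI ->.
rewrite -prod_mult_seq.
have := eq_prod_pairing G_neq0 eq_inv (s := [seq (psi, R psi) | psi <- mult_seq m]).
rewrite !big_map size_map size_mult_seq => /(_ md).
have -> : \prod_(psi <- mult_seq m) pairing (R psi) w^K =
    (\prod_(psi <- mult_seq m) t psi) * \prod_(psi <- mult_seq m) pairing (R psi) v^K.
  rewrite -big_split; apply: eq_big_seq => psi /m_I psiI /=.
  by apply: tE => //; have [] := RP psi psiI.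
set p := \prod_(psi <- _) pairing _ _ => eqp.
have p_neq0 : p != 0.
  by rewrite prodf_seq_neq0; apply/allP => psi /m_I/RP[].
apply: (mulIf p_neq0); rewrite mul1r -eqp //.
- by move=> _ /mapP[psi /m_I/RP[wR _] ->].
by move=> g; rewrite big_map prod_mult_seq; move/in_BP: Bm.
Qed.

End EqualInvariants.

Lemma same_orbit v w :
  (forall f, Defs.invariant rG f -> (msize f <= d.+1)%N -> eval_cV f v = eval_cV f w) ->
  exists g, w = rG g *m v.
Proof.
move=> eq_inv; have [I suppI] := exists_support v; have [J suppJ] := exists_support w.
have eq_inv' f : Defs.invariant rG f -> (msize f <= d.+1)%N ->
  eval_cV f w = eval_cV f v by move=> *; apply/esym/eq_inv.
(* Outside [I] the value 1 is chosen, so that [t] is nonzero everywhere. *)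
have /fin_all_exists2[t t_neq0 tE] chi : exists2 t : K, t != 0 &
    chi \in I -> forall r, weight_row rG chi r -> pairing r w^K = t * pairing r v^K.
  case: (boolP (chi \in I)) => [chiI|_]; last by exists 1; rewrite ?oner_neq0.
  by have [t t_neq0 tE] := weight_proportional eq_inv suppI chiI; exists t.
have [h hP] := exists_evaluation_point (primitive_exponent_card_neq0 prim_omega)
  (weight_ratio_relation eq_inv suppI t_neq0 (fun chi r chiI => tE chi chiI r)).
exists h; apply: (map_mx_inj (f := in_alg K)).
apply: (eq_weight_rows abelG prim_omega (rho := map_repr (in_alg K) rG)) => chi r wr.
suff rE : pairing r w^K = pairing r (rG h *m v)^K.
  by apply/matrixP => i j; rewrite !ord1.
rewrite (pairing_rG h v wr); have [chiI|chiI] := boolP (chi \in I).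
  by rewrite -hP // (tE chi).
have -> : pairing r v^K = 0.
  by apply/eqP; apply: contraNT chiI => rv; apply/suppI; exists r.
(* A row not vanishing on [w] would not vanish on [v] either, by proportionality with [v] and [w]
   exchanged. *)
rewrite mulr0; apply/eqP; apply: contraNT chiI => rw.
have chiJ : chi \in J by apply/suppJ; exists r.
have [u u_neq0 uE] := weight_proportional eq_inv' suppJ chiJ.
by apply/suppI; exists r; split=> //; rewrite uE // mulf_neq0.
Qed.

Lemma separating_of_Zspan : separating rG d.
Proof.
move=> v w neq_vw; case: (classic (exists f : {mpoly F[n]},
  [/\ Defs.invariant rG f, (msize f <= d.+1)%N & eval_cV f v <> eval_cV f w])) => //.
move=> nof; case: neq_vw.
have [|g ->] := @same_orbit v w.
  move=> f inv_f deg_f; case: (eqVneq (eval_cV f v) (eval_cV f w)) => // /eqP neq.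
  by case: nof; exists f.
move=> x; apply/codomP/codomP => -[h ->].
  by exists (h * g^-1)%g; rewrite mulmxA -repr_mxM ?inE // mulgKV.
by exists (h * g)%g; rewrite mulmxA -repr_mxM ?inE.
Qed.


End Separation.

(** * Existence of extremal values and the two bounds *)

Lemma exists_least (P : nat -> Prop) k : P k ->
  exists2 b, P b & (b <= k)%N /\ forall c, P c -> (b <= c)%N.
Proof.
elim/ltn_ind: k => k IHk Pk.
case: (classic (exists2 c, P c & (c < k)%N)) => [[c Pc ck]|noc].
  have [b Pb [bc bmin]] := IHk c ck Pc.
  by exists b => //; split=> //; apply: leq_trans bc (ltnW ck).
exists k => //; split=> // c Pc; rewrite leqNgt; apply/negP => ck.
by case: noc; exists c.
Qed.

Lemma exists_greatest (P : nat -> Prop) k : (exists b, P b) ->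
  (forall b, P b -> (b <= k)%N) -> exists2 b, P b & forall c, P c -> (c <= b)%N.
Proof.
(* The reflection of [c] to [k - c] turns a greatest element into a least one. *)
move=> [b0 Pb0] Pk; have Pkb0 : P (k - (k - b0))%N by rewrite subKn ?Pk.
have [c Pc [_ cmin]] := exists_least (P := fun c => P (k - c)%N) Pkb0.
exists (k - c)%N => // b Pb; rewrite -(subKn (Pk b Pb)) leq_sub2l // cmin ?subKn ?Pk //.
Qed.

Lemma beta_sep_le (G : finGroupType) (F : fieldType) n
  (rG : mx_representation F [set: G] n) d :
  (0 < d)%N -> separating rG d -> exists2 b, is_beta_sep rG b & (b <= d)%N.
Proof.
move=> d_gt0 sep_d.
have [b [b_gt0 sep_b] [bd bmin]] :=
  exists_least (P := fun b => (0 < b)%N /\ separating rG b) (conj d_gt0 sep_d).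
by exists b => //; split=> // c c_gt0 sep_c; apply: bmin.
Qed.

Theorem corollary5p6 (G : finGroupType) (abelG : abelian [set: G])
  (F : fieldType) (K : fieldExtType F) (omega : K)
  (prim_omega : (exponent [set: G]).-primitive_root omega)
  (gen_omega : <<1; omega>>%VS = {:K}%VS)
  (d : nat) (d_gt0 : (0 < d)%N)
  (hd : forall I : {set dual G K}, Gamma_stable I ->
     forall m, in_BI I m ->
       Zspan (fun u => exists m',
                [/\ in_BI I m', (total_mult m' <= d)%N & u = to_int m'])
             (to_int m)) :
  (exists2 b, is_beta_sep (fun_repr G F) b & (b <= d)%N) /\
  (exists2 b, is_beta_sep_max G F b & (b <= d)%N).
Proof.
have beta_d n (rG : mx_representation F [set: G] n) :
    exists2 b, is_beta_sep rG b & (b <= d)%N.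
  exact: beta_sep_le d_gt0 (separating_of_Zspan abelG prim_omega hd (rG := rG)).
split=> //.
have le_d b : (exists n (rG : mx_representation F [set: G] n), is_beta_sep rG b) ->
    (b <= d)%N.
  move=> [n [rG [b_gt0 sep_b bmin]]].
  exact: (bmin d d_gt0 (separating_of_Zspan abelG prim_omega hd (rG := rG))).
(* The values attained are bounded by [d], and the regular representation provides one, so the
   maximum exists. *)
have [|b Pb bmax] := exists_greatest _ le_d.
  by have [b betab _] := beta_d _ (fun_repr G F); exists b, #|G|, (fun_repr G F).
exists b; last exact: le_d.
split=> // n rG; have [c betac _] := beta_d n rG.
by exists c => //; apply: bmax; exists n, rG.
Qed.
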